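(* Let $A$ and $B$ be disjoint finite point sets in the plane such that $A\cup B$ is not collinear. Then the bivisibility graph $\mathcal{B}(A,B)$ has at most one connected component that is not an isolated vertex.
   Context: The bivisibility graph $\mathcal{B}(A,B)$ has vertex set $A\cup B$, where $v\in A$ and $w\in B$ are adjacent iff no point of $A\cup B$ lies in the open segment $vw$. *)

(* Defs.v *)
From HB Require Import structures.
From mathcomp Require Import all_boot all_order all_algebra.
From mathcomp Require Import finmap boolp reals.

Set Implicit Arguments.
Unset Strict Implicit.
Unset Printing Implicit Defensive.

Import Order.TTheory GRing.Theory Num.Theory.
Local Open Scope ring_scope.

Section Plane.
Variable R : realType.
Local Notation point := 'rV[R]_2.

Definition open_segment (v w p : point) : Prop :=
  exists t : R, 0 < t < 1 /\ p = (1 - t) *: v + t *: w.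

Definition collinear (S : {fset point}) : Prop :=
  exists a d : point, d != 0 /\
    forall x, x \in S -> exists t : R, x = a + t *: d.

Definition bivisibility (A B : {fset point}) : rel (A `|` B)%fset :=
  fun x y =>
    ((val x \in A) && (val y \in B) || (val y \in A) && (val x \in B)) &&
    `[< forall p, p \in (A `|` B)%fset -> ~ open_segment (val x) (val y) p >].

End Plane.

(* For a symmetric e, connect e is an equivalence relation, and its classes are
   the vertex sets of the connected components. *)
Definition components (T : finType) (e : rel T) : {set {set T}} :=
  equivalence_partition (connect e) [set: T].

(* A component is an isolated vertex exactly when it has a single vertex. *)
Definition nontrivial_components (T : finType) (e : rel T) : {set {set T}} :=
  [set C in components e | #|C| != 1%N].

(* Main.v *)
Require Import Defs.
From HB Require Import structures.
From mathcomp Require Import all_boot all_order all_algebra.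
From mathcomp Require Import finmap boolp reals.
From mathcomp Require Import ring lra.

Set Implicit Arguments.
Unset Strict Implicit.

Import Order.TTheory GRing.Theory Num.Theory.
Local Open Scope ring_scope.

(** Among all pairs of edges [ab], [cd] lying in different components and not
    on a common line, with [a], [c] of one colour and [b], [d] of the other,
    take one whose convex hull contains the fewest points.  Every segment
    with ends of different colours contains an edge; let [g] be one on [ad] and
    [h] one on [cb].  If [g] is in another component than [ab], then the pair
    ([ab], [g]) lies in the triangle [abd], so minimality forces [c] into that
    triangle or [a], [b], [d] onto a line; likewise for [g] and [cd], and for
    [h].  Signs of the four oriented areas exclude this when no three of the
    points are collinear.  If [a], [b], [d] are collinear, then either [b] is
    between [a] and [d] and [h] gives a smaller pair, or [a] is between [b] and
    [d], [h] is connected to [ab], [g] to [cd], and the pair ([g], [h]) is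
    smaller because it misses [c].  Edges of different components on a common
    line also yield such a pair: replace one of them by an edge on a segment
    joining the line to a point off it. *)

(** * Oriented areas, segments and strict separation in the plane *)

Section PlaneGeometry.
Variable R : realType.
Implicit Types a b c d p q w : 'rV[R]_2.

Definition lin (u v : R) p : R := u * p 0 0 + v * p 0 1.

(** Twice the signed area of the triangle [a b c]; it vanishes exactly when the three points are
    collinear. *)
Definition cross a b c : R :=
  (b 0 0 - a 0 0) * (c 0 1 - a 0 1) - (b 0 1 - a 0 1) * (c 0 0 - a 0 0).

Definition closed_segment a b p : Prop :=
  exists t : R, 0 <= t <= 1 /\ p = (1 - t) *: a + t *: b.

Lemma conv_coord (t : R) a b i :
  ((1 - t) *: a + t *: b) 0 i = (1 - t) * a 0 i + t * b 0 i.
Proof. by rewrite !mxE. Qed.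

Lemma point_eq p q : p 0 0 = q 0 0 -> p 0 1 = q 0 1 -> p = q.
Proof.
move=> e0 e1; apply/rowP => i; case: i => [[|[|]]] // hi.
- by rewrite (_ : Ordinal hi = 0) //; apply: val_inj.
- by rewrite (_ : Ordinal hi = 1) //; apply: val_inj.
Qed.

Lemma lin_conv u v t a b :
  lin u v ((1 - t) *: a + t *: b) = (1 - t) * lin u v a + t * lin u v b.
Proof. by rewrite /lin !conv_coord; ring. Qed.

Lemma cross_conv a b t p q : cross a b ((1 - t) *: p + t *: q) =
  (1 - t) * cross a b p + t * cross a b q.
Proof. by rewrite /cross !conv_coord; ring. Qed.

Lemma cross_conv2 a b s t p :
  cross ((1 - s) *: a + s *: b) ((1 - t) *: a + t *: b) p =
  (t - s) * cross a b p.
Proof. by rewrite /cross !conv_coord; ring. Qed.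

Lemma cross_rot a b c : cross b c a = cross a b c.
Proof. by rewrite /cross; ring. Qed.

Lemma cross_swap a b c : cross b a c = - cross a b c.
Proof. by rewrite /cross; ring. Qed.

Lemma cross_aba a b : cross a b a = 0.
Proof. by rewrite /cross; ring. Qed.

Lemma cross_abb a b : cross a b b = 0.
Proof. by rewrite /cross; ring. Qed.

Lemma cross_eq0_conv {a b c} : a != b -> cross a b c = 0 ->
  exists t : R, c = (1 - t) *: a + t *: b.
Proof.
move=> ab; rewrite /cross => abc.
have [e0|ne0] := eqVneq (b 0 0) (a 0 0).
  have ne1 : b 0 1 - a 0 1 != 0.
    rewrite subr_eq0; apply: contraNneq ab => e1.
    by apply/eqP/point_eq.
  exists ((c 0 1 - a 0 1) / (b 0 1 - a 0 1)).
  apply: point_eq; rewrite conv_coord; last by field.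
  have : (b 0 1 - a 0 1) * (c 0 0 - a 0 0) = 0.
    by move: abc; rewrite e0; lra.
  move/eqP; rewrite mulf_eq0 (negbTE ne1) /= subr_eq0 => /eqP ->.
  by rewrite e0; ring.
have ne : b 0 0 - a 0 0 != 0 by rewrite subr_eq0.
exists ((c 0 0 - a 0 0) / (b 0 0 - a 0 0)).
apply: point_eq; rewrite conv_coord; first by field.
apply: (mulfI ne); rewrite mulrDr mulrCA.
apply/eqP; rewrite -subr_eq0; apply/eqP.
rewrite -[RHS]abc; by field.
Qed.

Lemma cross_collinear {a b c d p} : a != b -> c != d ->
  cross a b c = 0 -> cross a b d = 0 -> cross a b p != 0 -> cross c d p != 0.
Proof.
move=> ab cd /(cross_eq0_conv ab)[s ec] /(cross_eq0_conv ab)[t ed] abp.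
rewrite ec ed cross_conv2 mulf_neq0 // subr_eq0.
by apply: contraNneq cd => ts; rewrite ec ed ts.
Qed.

Lemma cross_collinear0 {a b c d} : a != b -> cross a b c = 0 ->
  cross a b d = 0 -> cross c d a = 0 /\ cross c d b = 0.
Proof.
move=> ab /(cross_eq0_conv ab)[s ->] /(cross_eq0_conv ab)[t ->].
by rewrite !cross_conv2 /cross; split; ring.
Qed.

Lemma closed_segment_sym a b p : closed_segment a b p -> closed_segment b a p.
Proof.
move=> [t [/andP[t0 t1] ->]]; exists (1 - t); split; first by apply/andP; lra.
by rewrite subKr addrC.
Qed.

Lemma closed_segmentl a b : closed_segment a b a.
Proof.
by exists 0; rewrite lexx ler01 subr0 scale1r scale0r addr0.
Qed.

Lemma closed_segmentr a b : closed_segment a b b.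
Proof. exact/closed_segment_sym/closed_segmentl. Qed.

Lemma closed_segment_conv a b p q w : closed_segment a b p ->
  closed_segment a b q -> closed_segment p q w -> closed_segment a b w.
Proof.
move=> [s [/andP[s0 s1] ->]] [t [/andP[t0 t1] ->]] [r [/andP[r0 r1] ->]].
exists ((1 - r) * s + r * t); split; first by apply/andP; nra.
by apply: point_eq; rewrite !conv_coord; ring.
Qed.

Lemma open_segment_sym a b p :
  open_segment a b p -> open_segment b a p.
Proof.
move=> [t [/andP[t0 t1] ->]]; exists (1 - t); split; first by apply/andP; lra.
by rewrite subKr addrC.
Qed.

Lemma open_closed_segment a b p : open_segment a b p -> closed_segment a b p.
Proof.
by move=> [t [/andP[t0 t1] ->]]; exists t; split=> //; apply/andP; lra.
Qed.

(** With [c] off the line [ab], the lines [ac] and [ab] meet only in [a], and at most one of the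
    distinct points [p], [q] is [a]. *)
Lemma closed_segment_cross a b p q c : closed_segment a b p ->
  closed_segment a b q -> p != q -> cross a c b != 0 ->
  (cross a c p != 0) || (cross a c q != 0).
Proof.
move=> [s [_ ->]] [t [_ ->]] pq acb; rewrite !cross_conv.
rewrite cross_aba !mulr0 !add0r !mulf_eq0 (negbTE acb) !orbF -negb_and.
by apply: contra pq => /andP[/eqP -> /eqP ->].
Qed.

Lemma lin_closed_segment_lt u v a b p (m : R) : closed_segment a b p ->
  lin u v a < m -> lin u v b < m -> lin u v p < m.
Proof.
move=> [t [/andP[t0 t1] ->]]; rewrite lin_conv => ha hb.
have [t_gt0|t_le0] := ltP 0 t; first by nra.
have -> : t = 0 by lra.
by lra.
Qed.

Definition separated (w : 'rV[R]_2) (s : seq 'rV[R]_2) :=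
  exists u v : R, all (fun p => lin u v p < lin u v w) s.

(** The oriented area is affine in its last argument. The witnesses are the coefficients of its
    linear part, scaled by [k]; the constant term cancels. *)
Lemma cross_separated k a b w s :
  all (fun p => k * cross a b p < k * cross a b w) s -> separated w s.
Proof.
move=> h; exists (k * (a 0 1 - b 0 1)), (k * (b 0 0 - a 0 0)).
apply: sub_all h => p; rewrite /cross /lin; nra.
Qed.

(** The three products are the barycentric coordinates of [w] up to a positive factor. If one is
    negative, the line through that side separates [w] from the triangle. *)
Lemma separated_or a b c w : cross a b c != 0 -> separated w [:: a; b; c] \/
  [/\ 0 <= cross a b w * cross a b c, 0 <= cross b c w * cross a b c &
      0 <= cross c a w * cross a b c].
Proof.
move=> abc.
have sq : 0 < cross a b c * cross a b c.
  by rewrite -expr2 exprn_even_gt0.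
have [h1|h1] := ltP (cross a b w * cross a b c) 0.
  left; apply: (@cross_separated (- cross a b c) a b) => /=.
  by rewrite cross_aba cross_abb; apply/and4P; split=> //; nra.
have [h2|h2] := ltP (cross b c w * cross a b c) 0.
  left; apply: (@cross_separated (- cross a b c) b c) => /=.
  by rewrite cross_aba cross_abb (cross_rot a b c); apply/and4P; split=> //; nra.
have [h3|h3] := ltP (cross c a w * cross a b c) 0.
  left; apply: (@cross_separated (- cross a b c) c a) => /=.
  by rewrite cross_aba cross_abb -(cross_rot c a b); apply/and4P; split=> //; nra.
by right.
Qed.

(** The product of the three pairwise products is the square of [x * y * z]. *)
Lemma no_three_opposite (x y z : R) : x != 0 -> y != 0 -> z != 0 ->
  x * y <= 0 -> x * z <= 0 -> y * z <= 0 -> False.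
Proof.
move=> x0 y0 z0 xy xz yz.
have : 0 < (x * y * z) ^+ 2 by rewrite exprn_even_gt0 //= !mulf_neq0.
suff : (x * y) * ((x * z) * (y * z)) <= 0 by nra.
by rewrite mulr_le0_ge0 // mulr_le0.
Qed.

End PlaneGeometry.

(** * Two-coloured point sets: visibility edges and finite convex hulls *)

Section BicolouredPoints.
Variables (R : realType) (T : finType) (pos : T -> 'rV[R]_2) (col : T -> bool).
Hypothesis pos_inj : injective pos.
Implicit Types a b c d p q r w x y z : T.

Definition adj : rel T := fun x y =>
  (col x != col y) && `[< forall z, ~ open_segment (pos x) (pos y) (pos z) >].

Lemma adj_sym : symmetric adj.
Proof.
move=> x y; rewrite /adj eq_sym; congr (_ && _).
by apply/asboolP/asboolP => h z /open_segment_sym; apply: h.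
Qed.

Lemma connect_adj_sym : connect_sym adj.
Proof. by apply: sym_connect_sym; exact: adj_sym. Qed.

Lemma adj_neq x y : adj x y -> pos x != pos y.
Proof.
move=> /andP[h _]; rewrite (inj_eq pos_inj).
by apply: contraNneq h => ->.
Qed.

Definition inner x y : {set T} :=
  [set z | `[< open_segment (pos x) (pos y) (pos z) >]].

Lemma inner_sym x y : inner x y = inner y x.
Proof.
by apply/setP => z; rewrite !inE; apply/asboolP/asboolP; apply: open_segment_sym.
Qed.

Lemma inner_proper x y z : pos x != pos y -> z \in inner x y ->
  inner x z \proper inner x y.
Proof.
move=> xy; rewrite inE => /asboolP[t [/andP[t0 t1] ez]].
apply/properP; split.
  apply/subsetP => w; rewrite !inE => /asboolP[s [/andP[s0 s1] ew]].
  apply/asboolP; exists (s * t); split; first by apply/andP; nra.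
  by rewrite ew ez; apply: point_eq; rewrite !conv_coord; ring.
exists z; first by rewrite inE; apply/asboolP; exists t; rewrite t0 t1.
rewrite inE; apply/asboolP => -[s [/andP[s0 s1] ez']].
have : ((1 - s) * t) *: (pos y - pos x) = 0.
  have coord i : (1 - s) * t * (pos y 0 i - pos x 0 i) = 0.
    have /(congr1 (fun p : 'rV_2 => p 0 i)) := ez'; rewrite {}ez !conv_coord.
    by move=> e; lra.
  by apply: point_eq; rewrite !mxE coord.
move/eqP; rewrite scaler_eq0 subr_eq0 [pos y == _]eq_sym (negbTE xy) orbF.
by rewrite mulf_eq0; apply/negP; rewrite negb_or; apply/andP; split; lra.
Qed.

(** Induction on the number of points inside the segment: an inner point replaces the end of its own
    colour, which leaves a shorter segment with ends of different colours. *)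
Lemma segment_edge x y : col x != col y -> exists p q, [/\ adj p q,
  col p = col x, closed_segment (pos x) (pos y) (pos p) &
  closed_segment (pos x) (pos y) (pos q)].
Proof.
have [n] := ubnP #|inner x y|.
elim: n x y => // n IH x y; rewrite ltnS => le_n cxy.
have nxy : pos x != pos y.
  by rewrite (inj_eq pos_inj); apply: contraNneq cxy => ->.
have [/eqP inner0|[z zin]] := set_0Vmem (inner x y).
  exists x, y; split=> //; last exact: closed_segmentr.
    rewrite /adj cxy; apply/asboolP => z hz.
    by move/setP/(_ z): (eqP inner0); rewrite !inE; move/asboolP: hz => ->.
  exact: closed_segmentl.
have zseg : closed_segment (pos x) (pos y) (pos z).
  by move: zin; rewrite inE => /asboolP; apply: open_closed_segment.
have [czx|czx] := eqVneq (col z) (col x).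
  have zyx : z \in inner y x by rewrite inner_sym.
  have [||p [q [pq cp sp sq]]] := IH z y; last 1 first.
  - exists p, q; split=> //; first by rewrite cp.
    + exact: closed_segment_conv zseg (closed_segmentr _ _) sp.
    + exact: closed_segment_conv zseg (closed_segmentr _ _) sq.
  - rewrite eq_sym in nxy.
    apply: leq_trans le_n.
    by rewrite inner_sym [inner x y]inner_sym proper_card // inner_proper.
  - by rewrite czx.
have [||p [q [pq cp sp sq]]] := IH x z; last 1 first.
- exists p, q; split=> //.
  + exact: closed_segment_conv (closed_segmentl _ _) zseg sp.
  + exact: closed_segment_conv (closed_segmentl _ _) zseg sq.
- apply: leq_trans le_n.
  by rewrite proper_card // inner_proper.
- by rewrite eq_sym.
Qed.

(* The points of the configuration in the convex hull of [s], described as those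
   that no linear form separates strictly from [s]. *)
Definition hull (s : seq T) : {set T} :=
  [set w | ~~ `[< separated (pos w) (map pos s) >]].

Lemma in_hull {s w} : reflect (~ separated (pos w) (map pos s)) (w \in hull s).
Proof. by rewrite inE; apply: (iffP idP) => /asboolPn. Qed.

Lemma mem_hull s w : w \in s -> w \in hull s.
Proof.
move=> ws; apply/in_hull => -[u [v /allP /(_ (pos w))]].
by rewrite map_f // ltxx => /(_ isT).
Qed.

Lemma hull_segment s x y w : x \in s -> y \in s ->
  closed_segment (pos x) (pos y) (pos w) -> w \in hull s.
Proof.
move=> xs ys xyw; apply/in_hull => -[u [v /allP h]].
have := lin_closed_segment_lt xyw (h _ (map_f pos xs)) (h _ (map_f pos ys)).
by rewrite ltxx.
Qed.

(** A form that separates [z] from [s] takes on [s'] only values below its value at [z], since no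
    point of [s'] is separated from [s]. So it separates [z] from [s'] too. *)
Lemma hull_proper s s' w : w \in s -> {subset s' <= hull s} ->
  separated (pos w) (map pos s') -> hull s' \proper hull s.
Proof.
move=> ws s's sep; apply/properP; split.
  apply/subsetP => z /in_hull hz; apply/in_hull => -[u [v h]].
  apply: hz; exists u, v; apply/allP => _ /mapP[y ys' ->].
  have /in_hull hy := s's _ ys'.
  rewrite ltNge; apply/negP => le_zy; apply: hy; exists u, v.
  by apply: sub_all h => p /lt_le_trans; apply.
by exists w; [exact: mem_hull | apply/in_hull => /(_ sep)].
Qed.

Lemma eq_hull s s' : s =i s' -> hull s = hull s'.
Proof.
move=> ss'; apply/setP => w; apply/in_hull/in_hull => h [u [v hs]]; apply: h;
  exists u, v; apply/allP => _ /mapP[y ys ->];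
  apply: (allP hs); apply: map_f; first [by rewrite ss' | by rewrite -ss'].
Qed.

(** * Pairs of edges in different components, and minimal such pairs *)

Local Notation X a b c := (cross (pos a) (pos b) (pos c)).

Definition split_edges a b c d := [/\ adj a b, adj c d, ~~ connect adj a c,
  col a = col c & (X a b c != 0) || (X a b d != 0)].

Definition minimal a b c d := split_edges a b c d /\
  forall p q r s, split_edges p q r s ->
  (#|hull [:: a; b; c; d]| <= #|hull [:: p; q; r; s]|)%N.

(** Exchanging the two edges (swap) and exchanging the two colours (flip) generate the symmetries
    that carry an argument at one of the four points to the other three. *)
Lemma split_edges_swap a b c d : split_edges a b c d -> split_edges c d a b.
Proof.
case=> ab cd nac cac nX; split=> //; first by rewrite connect_adj_sym.
apply: contraLR nX; rewrite !negb_or !negbK => /andP[/eqP h1 /eqP h2].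
by have [-> ->] := cross_collinear0 (adj_neq cd) h1 h2; rewrite eqxx.
Qed.

Lemma adj_col x y : adj x y -> col y = ~~ col x.
Proof. by case/andP; case: (col x); case: (col y). Qed.

Lemma split_edges_flip a b c d : split_edges a b c d -> split_edges b a d c.
Proof.
case=> ab cd nac cac nX; split; rewrite 1?adj_sym //.
- apply: contra nac => bd; apply: connect_trans (connect1 ab) _.
  by apply: connect_trans bd _; rewrite connect1 // adj_sym.
- by rewrite (adj_col ab) (adj_col cd) cac.
- by rewrite !(cross_swap (pos a)) !oppr_eq0 orbC.
Qed.

Lemma minimal_swap a b c d : minimal a b c d -> minimal c d a b.
Proof.
move=> [/split_edges_swap bd h]; split=> // p q r s /h.
rewrite (@eq_hull [:: c; d; a; b] [:: a; b; c; d]) // => x; rewrite !inE.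
by case: (x == a); case: (x == b); case: (x == c); case: (x == d).
Qed.

Lemma minimal_flip a b c d : minimal a b c d -> minimal b a d c.
Proof.
move=> [/split_edges_flip bd h]; split=> // p q r s /h.
rewrite (@eq_hull [:: b; a; d; c] [:: a; b; c; d]) // => x; rewrite !inE.
by case: (x == a); case: (x == b); case: (x == c); case: (x == d).
Qed.

Lemma minimal_absurd a b c d p q r s w :
  minimal a b c d -> split_edges p q r s ->
  all [in hull [:: a; b; c; d]] [:: p; q; r; s] -> w \in [:: a; b; c; d] ->
  separated (pos w) (map pos [:: p; q; r; s]) -> False.
Proof.
move=> [_ h] /h; rewrite leqNgt => /negP lt_h sub ws sep; apply: lt_h.
exact: proper_card (hull_proper ws (allP sub) sep).
Qed.

(** Otherwise [ab] and [pq] would form a competing pair inside the triangle [abd], whose hull misses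
    [c]. *)
Lemma minimal_connect a b c d p q : minimal a b c d -> adj p q ->
  col p = col a -> closed_segment (pos a) (pos d) (pos p) ->
  closed_segment (pos a) (pos d) (pos q) -> X a b d != 0 ->
  separated (pos c) [:: pos a; pos b; pos d] -> connect adj a p.
Proof.
move=> mabcd pq cpa sp sq abd [u [v /= /and4P[ha hb hd _]]].
have [[ab _ _ _ _] _] := mabcd.
apply/negPn/negP => nap.
apply: (@minimal_absurd a b c d a b p q c mabcd).
- by split=> //; apply: closed_segment_cross sp sq (adj_neq pq) abd.
- rewrite /= andbT; apply/and4P; split.
  + by apply: mem_hull; rewrite !inE eqxx.
  + by apply: mem_hull; rewrite !inE eqxx orbT.
  + by apply: hull_segment sp; rewrite !inE eqxx ?orbT.
  + by apply: hull_segment sq; rewrite !inE eqxx ?orbT.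
- by rewrite !inE eqxx !orbT.
exists u, v; rewrite /= ha hb.
by rewrite (lin_closed_segment_lt sp) // (lin_closed_segment_lt sq).
Qed.

(* The edge found on [ad] would be connected to both [ab] and [cd]. *)
Lemma minimal_side a b c d : minimal a b c d -> X a b d != 0 ->
  separated (pos c) [:: pos a; pos b; pos d] -> X d c a != 0 ->
  separated (pos b) [:: pos d; pos c; pos a] -> False.
Proof.
move=> mabcd abd sc dca sb.
have [[ab cd nac cac _] _] := mabcd.
have cad : col a != col d by rewrite (adj_col cd) cac; case: (col c).
have [p [q [pq cp sp sq]]] := segment_edge cad.
have ap := minimal_connect mabcd pq cp sp sq abd sc.
have dq : connect adj d q.
  apply: (minimal_connect (minimal_flip (minimal_swap mabcd))
    (_ : adj q p) _ (closed_segment_sym sq) (closed_segment_sym sp)) => //.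
    by rewrite adj_sym.
  by rewrite (adj_col pq) cp (adj_col cd) cac.
move/negP: nac; apply; apply: connect_trans ap _.
apply: connect_trans (connect1 pq) _.
rewrite connect_adj_sym; exact: connect_trans (connect1 cd) dq.
Qed.

Lemma minimal_not_collinear a b c d : minimal a b c d -> X a b d != 0.
Proof.
move=> mabcd; apply/eqP => abd0.
have [[ab cd nac cac +] _] := mabcd; rewrite abd0 eqxx orbF => abc.
have nab := adj_neq ab.
have [t ed] := cross_eq0_conv nab abd0.
have K2 : 0 < X a b c * X a b c by rewrite -expr2 exprn_even_gt0.
(* A point [d] strictly between [a] and [b] would block the edge [ab]; [d = a] contradicts the
   colours, and [d = b] would connect [a] to [c]. *)
have t_out : t < 0 \/ 1 < t.
  have [|t0] := ltP t 0; first by left.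
  have [|t1] := ltP 1 t; first by right.
  exfalso; case/andP: ab => cab /asboolP /(_ d); apply.
  exists t; split=> //; rewrite !lt_neqAle t0 t1 !andbT eq_sym.
  apply/andP; split.
    apply: contraNneq cab => e0; move: ed.
    rewrite e0 subr0 scale1r scale0r addr0 => /pos_inj eda.
    by move: (adj_col cd); rewrite eda cac; case: (col c).
  apply: contraNneq nac => e1; move: ed.
  rewrite e1 subrr scale0r add0r scale1r => /pos_inj edb.
  apply: connect_trans (connect1 (_ : adj a b)) _; last first.
    by rewrite -edb connect1 // adj_sym.
  by case: (mabcd) => -[].
have bac : X b a c != 0 by rewrite cross_swap oppr_eq0.
(* For [1 < t], [b] lies between [a] and [d], so the line [bc] separates [a] from [d], and the
   swapped form of [minimal_side] applies. *)
have [t_lt0|t_gt1] := t_out; last first.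
  have bcd : X b c d = (1 - t) * X a b c.
    by rewrite ed cross_conv cross_aba (cross_rot (pos a)); ring.
  apply: (minimal_side (minimal_swap mabcd)) => //.
  - by rewrite (cross_rot (pos b)) bcd mulf_neq0 //; lra.
  - apply: (@cross_separated _ (X a b c) (pos b) (pos c)) => /=.
    rewrite bcd cross_aba cross_abb (cross_rot (pos a)).
    by apply/and4P; split=> //; nra.
  - apply: (@cross_separated _ (- X a b c) (pos b) (pos c)) => /=.
    rewrite bcd cross_aba cross_abb (cross_rot (pos a)).
    by apply/and4P; split=> //; nra.
(* Now [a] lies between [b] and [d], and the line [ac] separates [b] from [d]. *)
have acb : X a c b = - X a b c by rewrite /cross; ring.
have acd : X a c d = - t * X a b c.
  by rewrite ed cross_conv cross_aba acb; ring.
have cad : col a != col d by rewrite (adj_col cd) cac; case: (col c).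
have ccb : col c != col b by rewrite (adj_col ab) cac; case: (col c).
have [p [q [pq cp sp sq]]] := segment_edge cad.
have [r [s [rs cr sr ss]]] := segment_edge ccb.
have dq : connect adj d q.
  apply: (minimal_connect (minimal_flip (minimal_swap mabcd))
    (_ : adj q p) _ (closed_segment_sym sq) (closed_segment_sym sp)).
  - by rewrite adj_sym.
  - by rewrite (adj_col pq) cp (adj_col cd) cac.
  - have -> : X d c a = - X a c d by rewrite /cross; ring.
    by rewrite oppr_eq0 acd mulf_neq0 //; lra.
  - apply: (@cross_separated _ (- X a b c) (pos a) (pos c)) => /=.
    by rewrite acd acb cross_aba cross_abb; apply/and4P; split=> //; nra.
have bs : connect adj b s.
  apply: (minimal_connect (minimal_flip mabcd)
    (_ : adj s r) _ (closed_segment_sym ss) (closed_segment_sym sr)) => //.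
  - by rewrite adj_sym.
  - by rewrite (adj_col rs) cr (adj_col ab) cac.
  - apply: (@cross_separated _ (X a b c) (pos a) (pos c)) => /=.
    by rewrite acd acb cross_aba cross_abb; apply/and4P; split=> //; nra.
have as_ : connect adj a s by apply: connect_trans (connect1 ab) bs.
have ar : connect adj a r.
  by apply: connect_trans as_ _; rewrite connect1 // adj_sym.
have cq : connect adj c q by apply: connect_trans (connect1 cd) dq.
have on_ab x : closed_segment (pos a) (pos d) (pos x) -> X a b x = 0.
  by move=> [u [_ ->]]; rewrite cross_conv abd0 cross_aba; ring.
(* On the segment [cb], only [c] itself is as far from the line [ab] as [c], and [c] is not
   connected to [a]. Hence a parallel to [ab] separates [c] from the new pair. *)
have below x : closed_segment (pos c) (pos b) (pos x) -> connect adj a x ->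
    X a b c * X a b x < X a b c * X a b c.
  move=> [u [/andP[u0 u1] ex]] ax; rewrite ex cross_conv cross_abb.
  have : u != 0; last by nra.
  apply: contraNneq nac => e0; move: ex.
  by rewrite e0 subr0 scale1r scale0r addr0 => /pos_inj <-.
apply: (@minimal_absurd a b c d p q r s c mabcd).
- split=> //; last 2 first.
  + by rewrite cp cr.
  + have := closed_segment_cross (closed_segment_sym sr)
      (closed_segment_sym ss) (adj_neq rs) bac.
    rewrite !(cross_swap (pos a)) !oppr_eq0 => /orP[] h; apply/orP;
      [left | right];
      exact: (cross_collinear nab (adj_neq pq) (on_ab _ sp) (on_ab _ sq) h).
  apply: contra nac => pr; apply: connect_trans ar _.
  rewrite connect_adj_sym; apply: connect_trans cq _.
  by apply: connect_trans pr; rewrite connect1 // adj_sym.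
- rewrite /= andbT; apply/and4P; split.
  + by apply: hull_segment sp; rewrite !inE eqxx ?orbT.
  + by apply: hull_segment sq; rewrite !inE eqxx ?orbT.
  + by apply: hull_segment sr; rewrite !inE eqxx ?orbT.
  + by apply: hull_segment ss; rewrite !inE eqxx ?orbT.
- by rewrite !inE eqxx !orbT.
apply: (@cross_separated _ (X a b c) (pos a) (pos b)) => /=.
by rewrite (on_ab _ sp) (on_ab _ sq) mulr0 K2 !below.
Qed.

Lemma not_minimal a b c d : ~ minimal a b c d.
Proof.
move=> m.
have abd := minimal_not_collinear m.
have cdb := minimal_not_collinear (minimal_swap m).
have bac := minimal_not_collinear (minimal_flip m).
have dca := minimal_not_collinear (minimal_flip (minimal_swap m)).
have e1 : X a b c = - X b a c by rewrite /cross; ring.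
have e2 : X b d c = - X c d b by rewrite /cross; ring.
have e3 : X d c b = - X c d b by rewrite /cross; ring.
have e4 : X c a b = - X b a c by rewrite /cross; ring.
have e5 : X b c a = - X b a c by rewrite /cross; ring.
have e6 : X c b d = - X c d b by rewrite /cross; ring.
(* By [minimal_side] for the swapped pair, [a] lies in the triangle [cdb] or [d] in [bac]. Either
   way [a] and [d] are on the same side of the line [bc]. *)
have ad : X b a c * X c d b <= 0.
  have [sa|[_ _]] := separated_or (pos a) cdb; last by rewrite e5 mulNr oppr_ge0.
  have [sd|[_ _]] := separated_or (pos d) bac.
    by have := minimal_side (minimal_swap m) cdb sa bac sd.
  by rewrite e6 mulNr oppr_ge0 mulrC.
(* If [c] is in the triangle [abd], then [X b a c], [X c d b] and [X a b d] would have pairwise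
   opposite signs. The case of [b] in [dca] is alike, with [X d c a] as third area. *)
have [sc|] := separated_or (pos c) abd; last first.
  rewrite e1 e2 !mulNr !oppr_ge0 => -[c1 c2 _].
  exact: (no_three_opposite bac cdb abd).
have [sb|] := separated_or (pos b) dca; last first.
  rewrite e3 e4 !mulNr !oppr_ge0 => -[b1 b2 _].
  exact: (no_three_opposite bac cdb dca).
exact: (minimal_side m abd sc dca sb).
Qed.

(** Descent on the size of the hull: a pair with no smaller competitor would be minimal. *)
Lemma not_split_edges a b c d : ~ split_edges a b c d.
Proof.
have [n] := ubnP #|hull [:: a; b; c; d]|.
elim: n a b c d => // n IH a b c d; rewrite ltnS => le_n abcd.
apply: (@not_minimal a b c d); split=> // p q r s pqrs.
rewrite leqNgt; apply/negP => lt_h.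
exact: (IH p q r s (leq_trans lt_h le_n)).
Qed.

Lemma adj_connect a b c d : ~ (exists o v : 'rV[R]_2,
    v != 0 /\ forall x, exists t : R, pos x = o + t *: v) ->
  adj a b -> adj c d -> connect adj a c.
Proof.
move=> ncol ab.
wlog cac : c d / col a = col c => [hw cd|cd].
  have [|nac] := eqVneq (col a) (col c); first by move/hw; apply; exact: cd.
  apply: connect_trans (_ : connect adj d c); last by rewrite connect1 // adj_sym.
  apply: (hw d c); last by rewrite adj_sym.
  by rewrite (adj_col cd); move: nac; case: (col a); case: (col c).
apply/negPn/negP => nac.
have nab := adj_neq ab.
have [x abx] : exists x, X a b x != 0.
  apply: contrapT => /forallNP h; apply: ncol.
  exists (pos a), (pos b - pos a); split; first by rewrite subr_eq0 eq_sym.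
  move=> x; have /negP := h x; rewrite negbK => /eqP.
  move=> /(cross_eq0_conv nab)[t ->]; exists t.
  by apply: point_eq; rewrite conv_coord !mxE; ring.
have coll : X a b c = 0 /\ X a b d = 0.
  have [//|abc] := eqVneq (X a b c) 0; last first.
    by case: (@not_split_edges a b c d); split=> //; rewrite abc.
  have [//|abd] := eqVneq (X a b d) 0.
  by case: (@not_split_edges a b c d); split=> //; rewrite abd orbT.
(* All four ends now lie on one line and [x] lies off it. Exchanging colours if needed makes [bx] a
   segment with ends of different colours. *)
wlog cxa : a b c d ab cd cac nac nab abx coll / col x = col a => [hw|].
  have [|nxa] := eqVneq (col x) (col a); first exact: (hw a b c d).
  apply: (hw b a d c).
  - by rewrite adj_sym.
  - by rewrite adj_sym.
  - by rewrite (adj_col ab) (adj_col cd) cac.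
  - apply: contra nac => bd; apply: connect_trans (connect1 ab) _.
    by apply: connect_trans bd _; rewrite connect1 // adj_sym.
  - by rewrite eq_sym.
  - by rewrite cross_swap oppr_eq0.
  - by rewrite !(cross_swap (pos a)); case: coll => -> ->; rewrite oppr0.
  - by rewrite (adj_col ab); move: nxa; case: (col x); case: (col a).
have cbx : col b != col x by rewrite (adj_col ab) cxa; case: (col a).
have [p [q [pq cp sp sq]]] := segment_edge cbx.
have bax : X b a x != 0 by rewrite cross_swap oppr_eq0.
have nX := closed_segment_cross sp sq (adj_neq pq) bax.
(* The edge [pq] is not on the common line and cannot be connected to both [ab] and [cd], so with
   one of them it forms a split pair. *)
have [bp|nbp] := boolP (connect adj b p); last first.
  by apply: (@not_split_edges b a p q); split=> //; rewrite adj_sym.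
apply: (@not_split_edges d c p q); split=> //.
- by rewrite adj_sym.
- apply: contra nac => dp; apply: connect_trans (connect1 ab) _.
  apply: connect_trans bp _; rewrite connect_adj_sym.
  exact: connect_trans (connect1 cd) dp.
- by rewrite cp (adj_col ab) (adj_col cd) cac.
have [abc abd] := coll.
have bad0 : X b a d = 0 by rewrite cross_swap abd oppr0.
have bac0 : X b a c = 0 by rewrite cross_swap abc oppr0.
have nba : pos b != pos a by rewrite eq_sym.
have ndc : pos d != pos c by rewrite eq_sym adj_neq.
by case/orP: nX => h; rewrite (cross_collinear nba ndc bad0 bac0 h) ?orbT.
Qed.

End BicolouredPoints.

(** * From edges to connected components *)

Lemma nontrivial_component_edge (T : finType) (e : rel T) (C : {set T}) :
  C \in nontrivial_components e ->
  exists x y, e x y /\ C = [set z | connect e x z].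
Proof.
rewrite inE => /andP[/imsetP[x _ ->] card_neq1].
have [y xy yx] : exists2 y, connect e x y & y != x.
  apply: contrapT => none; move/negP: card_neq1; apply.
  apply/cards1P; exists x; apply/setP => y; rewrite !inE.
  apply/idP/eqP => [xy|->]; last exact: connect0.
  by apply/eqP/negPn/negP => yx; apply: none; exists y.
case/connectP: xy yx => -[_ -> /eqP //|z s /= /andP[xz _] _ _].
by exists x, z; split=> //; apply/setP => w; rewrite !inE.
Qed.

Theorem theorem22 (R : realType) (A B : {fset 'rV[R]_2})
    (disjAB : [disjoint A & B]%fset) (ncolAB : ~ collinear (A `|` B)%fset) :
  (#|nontrivial_components (@bivisibility R A B)| <= 1)%N.
Proof.
set T := (A `|` B)%fset.
pose e := adj (fun x : T => val x) (fun x : T => val x \in A).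
(* Disjointness makes membership in [A] a colouring whose other class is [B], so the bivisibility
   relation coincides with [adj]. *)
have BE (x : T) : (val x \in B) = (val x \notin A).
  have := valP x; rewrite in_fsetU => /orP[xA|xB].
    by rewrite xA; apply/negbTE; apply: (fdisjointP disjAB).
  by rewrite xB; apply/esym/(fdisjointP_sym disjAB).
have eE : @bivisibility R A B =2 e.
  move=> x y; rewrite /bivisibility /e /adj; congr (_ && _).
    by rewrite !BE; case: (val x \in A); case: (val y \in A).
  apply/asboolP/asboolP => h.
    by move=> z; apply: h; exact: valP.
  by move=> p pAB; exact: (h [` pAB]%fset).
have conE : connect (@bivisibility R A B) =2 connect e by apply: eq_connect.
have ncol : ~ (exists o v : 'rV[R]_2,
    v != 0 /\ forall x : T, exists t : R, val x = o + t *: v).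
  move=> [o [v [v0 h]]]; apply: ncolAB; exists o, v; split=> // x xAB.
  exact: (h [` xAB]%fset).
rewrite leqNgt; apply/negP => /card_gt1P[C [D [HC HD CD]]].
have [a [b [ab eC]]] := nontrivial_component_edge HC.
have [c [d [cd eD]]] := nontrivial_component_edge HD.
move/eqP: CD; apply; rewrite eC eD; apply/setP => z; rewrite !inE !conE.
rewrite !eE in ab cd.
apply: (same_connect (connect_adj_sym _ _)).
exact: (adj_connect val_inj ncol ab cd).
Qed.
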